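(* Let $\mathcal{A}=(a_i)_{i=1}^\infty$ be a non-decreasing sequence of positive integers and let $k$ be a positive integer. The Bessenrodt–Ono inequality for $p_{\mathcal{A}}(n,k)$ occurs (that is, there exists a constant $N$ such that $p_{\mathcal{A}}(a,k)\,p_{\mathcal{A}}(b,k)>p_{\mathcal{A}}(a+b,k)$ for all integers $a,b>N$) if and only if $k\geqslant 2$ and $\gcd(a_1,a_2,\ldots,a_k)=1$.
   Context: For a non-decreasing sequence $\mathcal{A}=(a_i)_{i=1}^\infty$ of positive integers, a positive integer $k$ and an integer $n\geqslant 0$, $p_{\mathcal{A}}(n,k)$ (the multicolor restricted partition function) denotes the number of partitions of $n$ with parts in the multiset $\{a_1,\ldots,a_k\}$, where equal entries $a_i=a_j$ with $i\neq j$ are regarded as distinct (differently colored) parts and the order of parts is irrelevant; equivalently $\sum_{n\geqslant 0}p_{\mathcal{A}}(n,k)x^n=\prod_{i=1}^k\frac{1}{1-x^{a_i}}$. *)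

(* Defs.v *)
From mathcomp Require Import all_boot.

Set Implicit Arguments.
Unset Strict Implicit.
Unset Printing Implicit Defensive.

(* Sequences are indexed from 0: [a i] is the (i+1)-st term a_{i+1}.

   A partition of n with parts in the multiset {a_1, ..., a_k}, equal entries
   being differently coloured, is determined by the multiplicity m i of each
   coloured part; as the parts are positive, each multiplicity is at most n, so
   the bound in 'I_n.+1 loses nothing (for parts equal to 0 the count would be
   infinite and this definition is not meaningful). *)
Definition restricted_partitions (a : nat -> nat) (k n : nat) :
    {set {ffun 'I_k -> 'I_n.+1}} :=
  [set m : {ffun 'I_k -> 'I_n.+1} | \sum_(i < k) m i * a i == n].

Definition pA (a : nat -> nat) (n k : nat) : nat :=
  #|restricted_partitions a k n|.

Definition bessenrodt_ono (a : nat -> nat) (k : nat) : Prop :=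
  exists N : nat, forall x y : nat, N < x -> N < y ->
    pA a (x + y) k < pA a x k * pA a y k.

(* Main.v *)
Require Import Defs.
From mathcomp Require Import all_boot.
From mathcomp Require Import zify.

(** Write [K = k - 1].  When the parts have gcd 1, [p(n)] has order of magnitude
[n ^ K]: forgetting one multiplicity is injective, so [p(n) <= (n + 1) ^ K]
([leq_pA_exp]), while a lattice-point construction yields a constant [D] with
[n ^ K <= D ^ K * p(n)] for all [n >= D] ([exp_leq_pA]).  Hence, for [x <= y]
both large, [p(x) p(y)] is at least [(x y / D ^ 2) ^ K] whereas [p(x + y)] is at
most [(3 y) ^ K]; as soon as [K >= 1] and [x > 3 D ^ 2] the former wins.

The lower bound rests on the following.  Let [L] be the product of the parts.
Since the gcd is 1, some non-negative combination [S] of the parts is congruent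
to 1 modulo [L] ([bezout_big_modn]), so [r S] with [r = n mod L] is a
representable number congruent to [n] whose size is bounded independently of
[n].  What remains, [n - r S = L q], can be distributed freely among the parts
in batches of size [L], each batch being made of [L / a_i] copies of [a_i]; this
gives as many partitions as there are ways to write [q] as a sum of [k]
non-negative integers, that is, at least [(q / k + 1) ^ K].

Conversely, if the gcd is not 1, arbitrarily large integers have no partition
at all, and if [k = 1] the multiples of the single part have exactly one; in both
cases the strict inequality fails for arbitrarily large arguments. *)

(** * Counting through injections *)

(** The bound on multiplicities built into [restricted_partitions] is automatic,
so families of partitions may be given by plain natural-number multiplicities. *)
Lemma leq_card_pA (a : nat -> nat) (k n : nat) (T : finType)
    (F : T -> 'I_k -> nat) :
    (forall i, 0 < a i) -> (forall t, \sum_(i < k) F t i * a i = n) ->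
    (forall t u, F t =1 F u -> t = u) ->
  #|T| <= pA a n k.
Proof.
move=> a_pos sumF injF.
have leFn t i : F t i < n.+1.
  rewrite ltnS -(sumF t) (bigD1 i) //=.
  by rewrite (leq_trans _ (leq_addr _ _)) // leq_pmulr.
pose G t : {ffun 'I_k -> 'I_n.+1} := [ffun i => inord (F t i)].
have valG t i : G t i = F t i :> nat by rewrite ffunE inordK.
have injG : injective G.
  by move=> t u eqG; apply: injF => i; rewrite -!valG eqG.
rewrite -(card_imset predT injG); apply: subset_leq_card.
apply/subsetP => _ /imsetP[t _ ->]; rewrite inE -[X in _ == X](sumF t).
by apply/eqP; apply: eq_bigr => i _; rewrite valG.
Qed.

(** The multiplicities of all parts but the first determine a partition of [n]. *)
Lemma leq_pA_exp (a : nat -> nat) (K n : nat) :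
  0 < a 0 -> pA a n K.+1 <= n.+1 ^ K.
Proof.
move=> a0_pos.
pose G (m : {ffun 'I_K.+1 -> 'I_n.+1}) : {ffun 'I_K -> 'I_n.+1} :=
  [ffun i => m (lift ord0 i)].
have <- : #|{ffun 'I_K -> 'I_n.+1}| = n.+1 ^ K by rewrite card_ffun !card_ord.
rewrite /pA -(@card_in_imset _ _ G) ?max_card // => m m'.
rewrite !inE !big_ord_recl => /eqP sum_m /eqP sum_m' eqG.
have eq_lift i : m (lift ord0 i) = m' (lift ord0 i).
  by have := congr1 (fun g : {ffun 'I_K -> 'I_n.+1} => g i) eqG; rewrite !ffunE.
apply/ffunP => i; case: (unliftP ord0 i) => [j ->|->]; first exact: eq_lift.
apply/val_inj/eqP; rewrite -(eqn_pmul2r a0_pos).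
have /eqP := etrans sum_m (esym sum_m').
by under eq_bigr => j _ do rewrite eq_lift; rewrite eqn_add2r.
Qed.

(** * Bezout's identity modulo a positive integer *)

(** Working modulo [L] makes all Bezout coefficients non-negative: a coefficient
[- u] can be replaced with [u * (L - 1)]. *)
Lemma bezout_modn (L m n : nat) :
  0 < L -> exists u v, u * m + v * n = gcdn m n %[mod L].
Proof.
case: L => // L _; case: (posnP m) => [->|m_pos].
  by exists 0, 1; rewrite gcd0n mul1n.
have [v _ /dvdnP[u def_u]] := Bezoutl n m_pos; exists u, (v * L).
rewrite -def_u -addnA [v * L * n]mulnAC -mulnS addnC.
by rewrite modnMDl.
Qed.

Lemma bezout_big_modn (a : nat -> nat) (k L : nat) :
    0 < L ->
  exists c : nat -> nat,
    \sum_(i < k) c i * a i = \big[gcdn/0]_(i < k) a i %[mod L].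
Proof.
move=> L_pos; elim: k => [|k [c IH]]; first by exists id; rewrite !big_ord0.
have [u [v def_uv]] := bezout_modn L (\big[gcdn/0]_(i < k) a i) (a k) L_pos.
exists (fun i => if i < k then u * c i else v).
rewrite !big_ord_recr /= ltnn -def_uv.
under eq_bigr => i _ do rewrite ltn_ord -mulnA.
by rewrite -big_distrr /= -modnDml -modnMmr IH modnMmr modnDml.
Qed.

(** * The lower bound *)

(** Free choices [f i <= q / (K + 1)] for all but one summand leave a
non-negative value for the remaining one, which makes the total equal to [q]. *)
Lemma composition_extension (K q : nat)
    (f : {ffun 'I_K -> 'I_(q %/ K.+1).+1}) :
  \sum_(i < K.+1) oapp (fun j => f j : nat) (q - \sum_(j < K) f j)
    (unlift ord0 i) = q.
Proof.
rewrite big_ord_recl unlift_none /=.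
under [X in _ + X]eq_bigr => i _ do rewrite liftK /=.
rewrite subnK //; apply: (@leq_trans (\sum_(j < K) q %/ K.+1)).
  by apply: leq_sum => j _; rewrite -ltnS.
rewrite sum_nat_const card_ord mulnC.
by apply: leq_trans (leq_trunc_div q K.+1); rewrite leq_mul2l leqnSn orbT.
Qed.

Lemma exp_leq_pA (a : nat -> nat) (K : nat) :
    (forall i, 0 < a i) -> \big[gcdn/0]_(i < K.+1) a i = 1 ->
  exists D, forall n, D <= n -> n ^ K <= D ^ K * pA a n K.+1.
Proof.
move=> a_pos gcd_a; pose L := \prod_(i < K.+1) a i.
have L_pos : 0 < L by apply: prodn_gt0.
have dvdaL (i : 'I_K.+1) : L %/ a i * a i = L.
  by rewrite divnK // /L (bigD1 i) //= dvdn_mulr.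
have [c] := bezout_big_modn a K.+1 L L_pos; rewrite gcd_a.
set S := \sum_(i < _) _ => S1.
exists (L * S + L * K.+1) => n le_n; pose r := n %% L.
have rS_le : r * S <= L * S by rewrite leq_mul2r ltnW ?orbT ?ltn_pmod.
have rS_le_n : r * S <= n.
  by rewrite (leq_trans rS_le) // (leq_trans _ le_n) ?leq_addr.
have /dvdnP[q def_q] : L %| n - r * S.
  by rewrite -eqn_mod_dvd // -modnMmr S1 modnMmr muln1 modn_mod.
have def_n : n = r * S + q * L by rewrite -def_q subnKC.
pose Q := q %/ K.+1.
pose J (f : {ffun 'I_K -> 'I_Q.+1}) i :=
  oapp (fun j => f j : nat) (q - \sum_(j < K) f j) (unlift ord0 i).
pose F f (i : 'I_K.+1) := r * c i + J f i * (L %/ a i).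
have card_le : Q.+1 ^ K <= pA a n K.+1.
  have <- : #|{ffun 'I_K -> 'I_Q.+1}| = Q.+1 ^ K.
    by rewrite card_ffun !card_ord.
  apply: (@leq_card_pA a K.+1 n _ F) => // [f|f g eqF].
    under eq_bigr => i _ do rewrite mulnDl -!mulnA dvdaL.
    by rewrite big_split -big_distrr -big_distrl /= composition_extension.
  apply/ffunP => j; apply: val_inj; have /eqP := eqF (lift ord0 j).
  rewrite /F /J liftK /= eqn_add2l eqn_pmul2r => [/eqP //|].
  have := dvdaL (lift ord0 j); case: (L %/ _) => // L0.
  by rewrite -L0 in L_pos.
(* [q < (K + 1) * Q.+1] by definition of [Q], and [r S <= L S]. *)
apply: (@leq_trans (((L * S + L * K.+1) * Q.+1) ^ K)).
  have n_le : n <= (L * S + L * K.+1) * Q.+1.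
    rewrite def_n mulnDl leq_add //; first by rewrite (leq_trans rS_le) ?leq_pmulr.
    by rewrite mulnC -mulnA leq_mul2l [K.+1 * _]mulnC ltnW ?orbT ?ltn_ceil.
  by case: (posnP K) => [->//|K_pos]; rewrite leq_exp2r.
by rewrite expnMn leq_mul2l card_le orbT.
Qed.

(** * The inequality *)

Lemma bessenrodt_ono_of_gcd1 (a : nat -> nat) (K : nat) :
    (forall i, 0 < a i) -> 0 < K -> \big[gcdn/0]_(i < K.+1) a i = 1 ->
  bessenrodt_ono a K.+1.
Proof.
move=> a_pos K_pos gcd_a; have [D lowD] := exp_leq_pA a K a_pos gcd_a.
exists (D + 3 * D ^ 2) => x y.
wlog le_xy : x y / x <= y.
  move=> IH ltx lty; case: (leqP x y) => [|/ltnW] le_xy; first exact: IH.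
  by rewrite addnC mulnC; apply: IH.
move=> ltx lty; rewrite ltnNge; apply/negP => le_prod.
have leDx : D <= x by lia.
have leDy : D <= y by lia.
have up : pA a (x + y) K.+1 <= (3 * y) ^ K.
  apply: leq_trans (leq_pA_exp a K _ (a_pos 0)) _.
  by rewrite leq_exp2r //; lia.
have : (x * y) ^ K <= (3 * D ^ 2 * y) ^ K.
  rewrite expnMn (leq_trans (leq_mul (lowD x leDx) (lowD y leDy))) //.
  rewrite mulnACA -expnMn mulnn [3 * _]mulnC -mulnA [in leqRHS]expnMn.
  by rewrite leq_mul2l (leq_trans le_prod) ?orbT.
by rewrite leq_exp2r // leq_pmul2r; lia.
Qed.

(** If the gcd is some [d > 1], the sum of a partition is a multiple of [d], so
[p(N d + 1) = 0] and no strict inequality can have it as a factor. *)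
Lemma bessenrodt_ono_gcd1 (a : nat -> nat) (k : nat) :
    (forall i, 0 < a i) -> 0 < k -> bessenrodt_ono a k ->
  \big[gcdn/0]_(i < k) a i = 1.
Proof.
move=> a_pos k_pos [N ineq]; set d := \big[gcdn/0]_(i < k) a i.
have dvd_d (i : 'I_k) : d %| a i by rewrite /d (bigD1 i) //= dvdn_gcdl.
have d_pos : 0 < d by apply: dvdn_gt0 (a_pos _) (dvd_d (Ordinal k_pos)).
apply/eqP; rewrite eqn_leq d_pos andbT leqNgt; apply/negP => d_gt1.
pose x := N * d + 1.
have ltx : N < x by rewrite /x addn1 ltnS leq_pmulr.
have px0 : pA a x k = 0.
  apply: eq_card0 => m; rewrite inE; apply/eqP => sum_m.
  have : d %| x by rewrite -sum_m; apply: dvdn_sum => i _; apply: dvdn_mull.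
  by rewrite dvdn_addr ?dvdn_mull // dvdn1 => /eqP d1; rewrite d1 in d_gt1.
by have := ineq x x ltx ltx; rewrite px0.
Qed.

(** With a single part, [p] never exceeds 1 and equals 1 at its multiples. *)
Lemma bessenrodt_ono_gt1 (a : nat -> nat) (k : nat) :
    (forall i, 0 < a i) -> 0 < k -> bessenrodt_ono a k -> 1 < k.
Proof.
move=> a_pos; case: k => [//|[|//]] _ [N ineq].
pose x := N.+1 * a 0.
have ltx : N < x by rewrite /x leq_pmulr.
have px_le1 : pA a x 1 <= 1 by rewrite (leq_pA_exp a 0 x).
have pxx_ge1 : 1 <= pA a (x + x) 1.
  rewrite -[X in X <= _]card_unit.
  apply: (@leq_card_pA a 1 _ _ (fun _ _ => N.+1 + N.+1)) => // [_|[] []//].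
  by rewrite big_ord1 mulnDl.
have := ineq x x ltx ltx.
by rewrite ltnNge (leq_trans (leq_mul px_le1 px_le1)).
Qed.

Theorem corollary5p5 (a : nat -> nat) (a_pos : forall i : nat, 0 < a i)
    (a_nondecr : forall i j : nat, i <= j -> a i <= a j)
    (k : nat) (k_pos : 0 < k) :
  bessenrodt_ono a k <-> (2 <= k /\ \big[gcdn/0]_(i < k) a i = 1).
Proof.
split=> [ono|[k_gt1 gcd_a]].
  by split; [apply: bessenrodt_ono_gt1 ono | apply: bessenrodt_ono_gcd1 ono].
by case: k k_gt1 gcd_a {k_pos} => // K; apply: bessenrodt_ono_of_gcd1.
Qed.
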